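(* Let $G\subset U(V)$ be a finite complex reflection group and put $z(k)=\sum_{H\in\mathcal{A}}a_H(k)\in\mathbb{C}[G]$. This element has the following properties: (i) $z(k)$ is in the center of $\mathbb{C}[G]$. (ii) For an irreducible complex representation $(V_\tau,\tau)\in\hat G$, let $c_\tau(k)$ denote the scalar such that $z(k)$ acts on $V_\tau$ by multiplication with $c_\tau(k)$. Then $c_\tau(k)$ is a linear function of $k=(k_{C,i})$ with nonnegative integer coefficients. (iii) Let $\operatorname{triv}$ denote the trivial representation of $G$. Then $c_\tau(k)\equiv0$ (as a function of $k$) if and only if $\tau=\operatorname{triv}$.
   Context: $V$ is a finite dimensional complex Hilbert space. A complex reflection is an element $g\in U(V)$ of finite order such that $\operatorname{Ker}(g-\operatorname{Id})$ is a hyperplane; a finite complex reflection group is a finite subgroup $G\subset U(V)$ generated by complex reflections. For a hyperplane $H$, $G_H\subset G$ is the (cyclic) pointwise stabilizer; $H$ is a reflection hyperplane if $G_H\ne\{\operatorname{Id}\}$, and then $e_H=|G_H|$. $\mathcal{A}$ is the set of reflection hyperplanes, $\mathcal{C}$ the set of $G$-orbits in $\mathcal{A}$; $e_C=e_H$ for $H\in C$. $\chi_H=\det|_{G_H}$. Parameters $k=(k_{C,i})$ with $k_{C,i}\in\mathbb{C}$, $C\in\mathcal{C}$, $1\le i\le e_C-1$; $k_{H,i}=k_{C,i}$ if $H\in C$. Put $\epsilon_{H,i}=\frac1{e_H}\sum_{g\in G_H}\chi_H^i(g)g$ and $a_H(k)=\sum_{i=1}^{e_H-1}e_Hk_{H,i}\epsilon_{H,i}\in\mathbb{C}[G_H]$.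 $\hat G$ is the set of (isomorphism classes of) irreducible complex representations of $G$. *)

(* Defs.v *)
From HB Require Import structures.
From mathcomp Require Import all_boot all_order all_algebra.
From mathcomp Require Import all_fingroup all_character.
From mathcomp Require Import sesquilinear.
From mathcomp Require Import complex.
From mathcomp Require Import boolp classical_sets functions cardinality fsbigop.
From mathcomp Require Import reals.

Set Implicit Arguments.
Unset Strict Implicit.
Unset Printing Implicit Defensive.

Import Order.TTheory GRing.Theory Num.Theory.

Local Open Scope ring_scope.
Local Open Scope complex_scope.
Local Open Scope classical_set_scope.

Definition lfun_det (F : fieldType) (V : vectType F) (f : 'End(V)) : F :=
  \det (passmx.mxof (vbasis {:V}) (vbasis {:V}) f).

Lemma triv_mx_repr (F : fieldType) (gT : finGroupType) (G : {group gT}) :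
  mx_repr G (fun _ => 1%:M : 'M[F]_1).
Proof. by split=> // x y _ _; rewrite mulmx1. Qed.

Definition triv_repr (F : fieldType) (gT : finGroupType) (G : {group gT}) :
  mx_representation F G 1 := MxRepresentation (triv_mx_repr F G).

Section ComplexReflectionGroups.

Variables (R : realType) (V : vectType R[i]) (gT : finGroupType).
Variables (G : {group gT}) (rho : gT -> 'End(V)).

(* A finite subgroup of U(V) is given by an abstract finite group G together
   with an embedding rho of G into U(V). *)
Definition unitary_embedding (form : {dot V for (@Num.conj R[i])}) : Prop :=
  [/\ rho 1%g = \1%VF,
      {in G &, forall x y, rho (x * y)%g = (rho x \o rho y)%VF},
      {in G &, injective rho}
    & {in G, forall x, isometry form form (rho x)}].

Definition hyperplane (H : {vspace V}) : bool :=
  (\dim H).+1 == \dim {:V}.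

(* Elements of G automatically have finite order. *)
Definition complex_reflection (g : gT) : bool :=
  hyperplane (lker (rho g - \1%VF)).

Definition complex_reflection_group
    (form : {dot V for (@Num.conj R[i])}) : Prop :=
  unitary_embedding form /\
  <<[set g in G | complex_reflection g]>>%g = G :> {set gT}.

(* The pointwise stabilizer G_H. *)
Definition pstab (H : {vspace V}) : {set gT} :=
  [set g in G | (H <= fixedSpace (rho g))%VS]%SET.

Definition refl_hyperplanes : set {vspace V} :=
  [set H | hyperplane H /\ pstab H != 1%g].

Definition horbit (H : {vspace V}) : set {vspace V} :=
  [set (rho g @: H)%VS | g in [set g | g \in G]].

Definition horbits : set (set {vspace V}) := horbit @` refl_hyperplanes.

Definition ord_hyp (H : {vspace V}) : nat := #|pstab H|.

(* e_C, read off at an arbitrarily chosen member of C; it does not depend on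
   this choice, see [ord_orbE]. *)
Definition ord_orb (C : set {vspace V}) : nat := ord_hyp (xget 0%VS C).

(* A parameter k assigns k C i to an orbit C and 1 <= i < e_C; values at other
   arguments are never used. *)
Definition parameter : Type := set {vspace V} -> nat -> R[i].

(* C[G] is the algebra [group_ring] of matrices spanned by the images of the
   group elements under the regular representation; g is identified with
   [regular_repr R[i] G g]. *)
Definition epsilon (H : {vspace V}) (i : nat) : 'M[R[i]]_#|G| :=
  (ord_hyp H)%:R^-1 *:
    \sum_(g in pstab H) lfun_det (rho g) ^+ i *: regular_repr R[i] G g.

Definition a_elt (k : parameter) (H : {vspace V}) : 'M[R[i]]_#|G| :=
  \sum_(1 <= i < ord_hyp H)
    ((ord_hyp H)%:R * k (horbit H) i) *: epsilon H i.

Definition z_elt (k : parameter) : 'M[R[i]]_#|G| :=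
  \sum_(H \in refl_hyperplanes) a_elt k H.

(* x in C[G] acts on the module of tau by multiplication with c. *)
Definition acts_by_scalar m (tau : mx_representation R[i] G m)
    (x : 'M[R[i]]_#|G|) (c : R[i]) : Prop :=
  gring_op tau x = c%:M.

Section Facts.

Variable form : {dot V for (@Num.conj R[i])}.
Hypothesis rhoP : unitary_embedding form.

Lemma refl_hyperplanes_finite : finite_set refl_hyperplanes.
Proof.
case: rhoP => rho1 rhoM rhoI _.
apply: (@sub_finite_set _ _ ((fun g => fixedSpace (rho g)) @` [set: gT])).
  move=> H [/eqP Hhyp stabN1] /=.
  have [/existsP[g /andP[gH gN1]]|] := boolP [exists g, (g \in pstab H) && (g != 1%g)].
    exists g => //; move: gH; rewrite inE => /andP[gG sHg]; apply/esym/eqP.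
    rewrite eqEdim sHg -ltnS Hhyp ltn_neqAle dimvS ?subvf// andbT.
    apply: contra gN1 => dimg; apply/eqP/rhoI => //.
    have /fixedSpacesP fixg : ({:V} <= fixedSpace (rho g))%VS.
      by rewrite -(geq_leqif (dimv_leqif_sup (subvf _))) (eqP dimg).
    by rewrite rho1; apply/lfunP => v; rewrite fixg ?memvf// lfunE.
  rewrite negb_exists => /forallP stab1; case/eqP: stabN1.
  apply/setP=> g; have := stab1 g; rewrite !inE.
  have [->|gN1] := eqVneq g 1%g; last by rewrite andbT => /negbTE.
  by rewrite group1 rho1 fixedSpace_id subvf.
exact/finite_image/finite_finset.
Qed.

Lemma ord_hyp_orbit (H H' : {vspace V}) : horbit H H' -> ord_hyp H' = ord_hyp H.
Proof.
case: rhoP => rho1 rhoM _ _.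
case=> g /= gG <-; rewrite /ord_hyp -(card_imset _ (conjg_inj g)).
have rhoK x : x \in G -> cancel (rho x) (rho x^-1%g).
  by move=> xG v; rewrite -comp_lfunE -rhoM ?groupV// mulVg rho1 lfunE.
apply: eq_card => x; apply/imsetP/idP => [[y yH ->]|xH].
  move: yH; rewrite !inE => /andP[yG /fixedSpacesP fixy].
  rewrite groupJ//=; apply/fixedSpacesP => v vH.
  rewrite conjgE !rhoM ?groupM ?groupV// !comp_lfunE fixy ?rhoK//.
  exact: memv_img.
move: xH; rewrite inE => /andP[xG /fixedSpacesP fixx].
exists (x ^ g^-1)%g; last by rewrite conjgKV.
rewrite inE groupJ ?groupV//=; apply/fixedSpacesP => _ /memv_imgP[v vH ->].
rewrite conjgE invgK !rhoM ?groupM ?groupV// !comp_lfunE.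
by rewrite rhoK// fixx.
Qed.

Lemma ord_orbE (H : {vspace V}) : ord_orb (horbit H) = ord_hyp H.
Proof.
apply: ord_hyp_orbit; case: xgetP => [_ -> //|/(_ H) []].
case: rhoP => rho1 _ _ _; exists 1%g; rewrite /= ?group1 ?rho1//.
by apply/vspaceP=> v; rewrite lim1g.
Qed.

End Facts.

End ComplexReflectionGroups.

(* Main.v *)
Require Import Defs.
From HB Require Import structures.
From mathcomp Require Import all_boot all_order all_algebra.
From mathcomp Require Import all_fingroup all_solvable all_field all_character.
From mathcomp Require Import sesquilinear.
From mathcomp Require Import complex finmap.
From mathcomp Require Import boolp classical_sets functions cardinality fsbigop.
From mathcomp Require Import reals.

(* Write [S_H,i] for [e_H epsilon_H,i], the sum of [chi_H(x)^i x] over [x] in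
   [G_H].  Conjugation by [g] carries [S_H,i] to [S_gH,i], so [z(k)] is central
   and acts on an irreducible [tau] by a scalar.  For the indicator [k] of
   [(C, i)] that scalar [n_C,i] satisfies
     [n_C,i dim tau = \sum_(H in C) e_H rank tau(epsilon_H,i)]
   since [epsilon_H,i] is idempotent, so it is a nonnegative rational.  It is
   also an algebraic integer, since the lattice spanned by the elements
   [det(h) tau(g)], with [h, g] in [G], is stable under [tau(S_H,i)].
   If all [n_C,i] vanish, then so do all [tau(epsilon_H,i)] with [0 < i < e_H];
   the [epsilon_H,i], [0 <= i < e_H], add up to 1, so [tau(epsilon_H,0) = 1] and
   every reflection acts trivially.  This uses that [chi_H] is faithful: an
   element of finite order fixing a hyperplane pointwise and of determinant 1 is
   unipotent, hence trivial. *)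

Set Implicit Arguments.
Unset Strict Implicit.
Unset Printing Implicit Defensive.

Import Order.TTheory GRing.Theory Num.Theory passmx.

Local Open Scope ring_scope.
Local Open Scope complex_scope.
Local Open Scope classical_set_scope.

(** * Rank-one perturbations of the identity and traces of idempotents *)

Lemma det_addmul_col_row (K : comRingType) n (u : 'cV[K]_n) (v : 'rV[K]_n) :
  \det (1%:M + u *m v) = 1 + (v *m u) 0 0.
Proof.
(* The two sides come from two factorizations of [M] into block triangular matrices. *)
pose M := block_mx (1%:M : 'M_1) (- v) u 1%:M.
have detL : \det M = \det (1%:M + u *m v).
  have -> : M = block_mx 1%:M 0 u 1%:M *m block_mx 1%:M (- v) 0 (1%:M + u *m v).
    rewrite mulmx_block !(mul1mx, mul0mx, mulmx0, mulmx1, addr0) mulmxN.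
    by rewrite addrCA addNr addr0.
  by rewrite det_mulmx det_lblock det_ublock !det1 !mul1r.
rewrite -detL.
have -> : M = block_mx (1%:M + v *m u) (- v) 0 1%:M *m block_mx 1%:M 0 u 1%:M.
  rewrite mulmx_block !(mul1mx, mul0mx, mulmx0, mulmx1, add0r) mulNmx.
  by rewrite addrK.
by rewrite det_mulmx det_lblock det_ublock !det1 !mulr1 det_mx11 !mxE.
Qed.

(** Write [A = 1 + u v]. Determinant 1 forces [v u = 0], so [A ^+ l = 1 + l u v]; for [l = k] this
    gives [k u v = 0], hence [u v = 0] in characteristic 0. *)
Lemma rank1_finite_order_det1 (K : numFieldType) n (A : 'M[K]_n) k :
  (\rank (A - 1%:M)%R <= 1)%N -> \det A = 1 -> (0 < k)%N -> A ^+ k = 1 -> A = 1.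
Proof.
move=> rkN detA k_gt0 Ak.
have [u [v Auv]] : exists u : 'cV_n, exists v : 'rV_n, A - 1%:M = u *m v.
  have := mulmx_base (A - 1%:M); move: (col_base _) (row_base _) rkN.
  case: (\rank _) => [|[|//]] u v _ <-; last by exists u, v.
  by exists 0, 0; rewrite mul0mx [v]flatmx0 mulmx0.
have AE : A = 1 + u *m v by rewrite -Auv addrC subrK.
have vu0 : v *m u = 0.
  apply/matrixP=> i j; rewrite !ord1 [RHS]mxE.
  by apply: (addrI 1); rewrite -det_addmul_col_row addr0 -[in RHS]detA AE.
have powA l : A ^+ l = 1 + (u *m v) *+ l.
  elim: l => [|l IHl]; first by rewrite expr0 mulr0n addr0.
  rewrite exprSr IHl AE mulrDr mulr1 mulrDl mul1r mulrnAl -[_ * _]mulmxA.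
  by rewrite (mulmxA v) vu0 mul0mx mulmx0 mul0rn addr0 -addrA -mulrSr.
move: Ak; rewrite powA => /(congr1 (fun B => B - 1)); rewrite subrr addrC addKr.
move=> uv0; rewrite AE; suff -> : u *m v = 0 by rewrite addr0.
move: uv0; rewrite -scaler_nat => /eqP; rewrite scaler_eq0 pnatr_eq0.
by rewrite -leqn0 leqNgt k_gt0 => /eqP.
Qed.

Lemma mxtrace_idem (K : fieldType) n (A : 'M[K]_n) :
  A *m A = A -> \tr A = (\rank A)%:R.
Proof.
move=> idA; rewrite -{1}(mulmx_base A) mxtrace_mulC.
(* In [A A = A], the factor [col_base A] cancels on the left and [row_base A] on the right. *)
suff -> : row_base A *m col_base A = 1%:M by rewrite mxtrace1.
apply: (row_free_inj (row_base_free A)); rewrite mul1mx -mulmxA mulmx_base.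
apply: (row_full_inj (col_base_full A)).
by rewrite mulmxA mulmx_base.
Qed.

(** * Integrality of rational scalars that preserve a lattice *)

Lemma eigenvalue_int_mx_rat (K : numFieldType) n (A : 'M[int]_n) (q : rat) :
  eigenvalue (map_mx (intr : int -> K) A) (ratr q) -> q \is a Num.int.
Proof.
rewrite eigenvalue_root_char -map_char_poly => rootK.
have rootQ : root (map_poly (intr : int -> rat) (char_poly A)) q.
  rewrite -(fmorph_root (ratr : rat -> K)) -map_poly_comp.
  by rewrite (eq_map_poly (rmorph_int ratr)).
(* The root moves on to [algC], where rational algebraic integers are known to be integers. *)
have rootC : root (map_poly (intr : int -> algC) (char_poly A)) (ratr q).
  move: rootQ; rewrite -(fmorph_root (ratr : rat -> algC)) -map_poly_comp.
  by rewrite (eq_map_poly (rmorph_int ratr)).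
have : (ratr q : algC) \in Num.int.
  apply: Cint_rat_Aint; first by apply/CratP; exists q.
  apply: root_monic_Aint rootC _ _; first exact/monic_map/char_poly_monic.
  by apply/polyOverP=> i; rewrite coef_map rpred_int.
case/intrP=> z; rewrite -(rmorph_int (ratr : rat -> algC)) => /fmorph_inj ->.
exact: intr_int.
Qed.

(** The family [w] generates the lattice and may be linearly dependent. Natural coefficients
    suffice, since the operators of interest are sums of maps that send the family to itself. *)
Definition integral_on (K : pzSemiRingType) m n (T : finType) (w : T -> 'M[K]_(m, n))
    (A : 'M[K]_m) : Prop :=
  exists M : T -> T -> nat, forall t, A *m w t = \sum_s w s *+ M t s.

Section IntegralOn.

Variables (m n : nat) (T : finType).

Lemma integral_on0 (K : pzSemiRingType) (w : T -> 'M[K]_(m, n)) : integral_on w 0.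
Proof. by exists (fun _ _ => 0%N) => t; rewrite mul0mx big1. Qed.

Lemma integral_onD (K : pzSemiRingType) (w : T -> 'M[K]_(m, n)) A B :
  integral_on w A -> integral_on w B -> integral_on w (A + B).
Proof.
move=> [M AM] [N BN]; exists (fun t s => M t s + N t s)%N => t.
by rewrite mulmxDl AM BN -big_split; apply: eq_bigr => s _; rewrite mulrnDr.
Qed.

Lemma integral_on_map (K : pzSemiRingType) (w : T -> 'M[K]_(m, n)) A (f : T -> T) :
  (forall t, A *m w t = w (f t)) -> integral_on w A.
Proof.
move=> Af; exists (fun t s => s == f t) => t; rewrite Af (bigD1 (f t))//= eqxx.
by rewrite big1 ?addr0// => s /negbTE ->.
Qed.

(** At a position [(i, j)] where [w t0] is nonzero, the entries of all the [w t] form an eigenvector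
    of an integer matrix, the transpose of [M], with eigenvalue [q]. *)
Lemma integral_on_ratr (K : numFieldType) (w : T -> 'M[K]_(m, n)) (q : rat) t0 :
  w t0 != 0 -> integral_on w (ratr q)%:M -> q \is a Num.int.
Proof.
move=> w0 [M wM].
have [i [j wij]] : exists i j, w t0 i j != 0.
  apply/not_existsP => w0'; case/eqP: w0; apply/matrixP => i j; rewrite mxE.
  by apply/eqP; apply: contrapT => /negP wij; apply: (w0' i); exists j.
pose A := \matrix_(b < #|T|, a < #|T|) (M (enum_val a) (enum_val b))%:Z.
apply: (@eigenvalue_int_mx_rat K _ A); apply/eigenvalueP.
exists (\row_a w (enum_val a) i j).
  apply/rowP=> a; rewrite !mxE.
  have /(congr1 (fun B : 'M_(m, n) => B i j)) := wM (enum_val a).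
  rewrite mul_scalar_mx mxE summxE => ->.
  rewrite [RHS](reindex_onto enum_val enum_rank) /=; last first.
    by move=> s _; rewrite enum_rankK.
  apply: eq_big => [b|b _]; first by rewrite enum_valK eqxx.
  by rewrite !mxE -[_%:~R]/(_%:R) mulr_natr mulmxnE.
apply: contra wij => /eqP/rowP/(_ (enum_rank t0)).
by rewrite !mxE enum_rankK => ->.
Qed.

End IntegralOn.

(** The image of [f] is at most a line, so every row of its matrix is a multiple of one coordinate
    row. *)
Lemma rank_mxof_codim1 (K : fieldType) (V : vectType K) (e : (\dim {:V}).-tuple V)
    (H : {vspace V}) (f : 'End(V)) :
  basis_of {:V} e -> (\dim {:V} <= (\dim H).+1)%N -> (H <= lker f)%VS ->
  (\rank (mxof e e f) <= 1)%N.
Proof.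
move=> eP dimH HK; set U := limg f.
have dimU : (\dim U <= 1)%N.
  have := limg_ker_dim f fullv; rewrite capfv -/U => dimE.
  rewrite -(leq_add2l (\dim (lker f))) dimE addn1.
  by rewrite (leq_trans dimH)// ltnS dimvS.
have UE : (U <= <[vpick U]>)%VS.
  have [->|UN0] := eqVneq U 0%VS; first exact: sub0v.
  rewrite -(geq_leqif (dimv_leqif_sup _)) -?memvE ?memv_pick//.
  by rewrite dim_vline vpick0 UN0.
apply: leq_trans (rank_leq_row (rVof e (vpick U))).
apply/mxrankS/rV_subP => _ /submxP[u ->]; rewrite mul_mxof.
have /(subvP UE)/vlineP[a ->] : f (vecof e u) \in U.
  by rewrite memv_img ?memvf.
by rewrite linearZ scalemx_sub.
Qed.

(** * Matrices and determinants of the group elements *)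

Section FiniteLinearGroup.

Variables (R : realType) (V : vectType R[i]).
Variable form : {dot V for (@Num.conj R[i])}.
Variables (gT : finGroupType) (G : {group gT}) (rho : gT -> 'End(V)).
Hypothesis rhoP : unitary_embedding G rho form.

Local Notation F := R[i].
Local Notation d x := (lfun_det (rho x)).
Local Notation stab := (pstab G rho).
Local Notation hyps := (refl_hyperplanes G rho).
Local Notation ord := (ord_hyp G rho).
Local Notation orb := (horbit G rho).
Local Notation mx g := (mxof (vbasis {:V}) (vbasis {:V}) (rho g)).

Let basisV : basis_of {:V} (vbasis {:V}) := vbasisP _.

Lemma mxof_rho1 : mx 1%g = 1%:M.
Proof. by case: rhoP => -> _ _ _; rewrite mxof1 ?(basis_free basisV). Qed.

(** The order is reversed because matrices act on row vectors. *)
Lemma mxof_rhoM x y : x \in G -> y \in G -> mx (x * y)%g = mx y *m mx x.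
Proof. by case: rhoP => _ rM _ _ xG yG; rewrite rM// (mxof_comp _ _ basisV). Qed.

Lemma mxof_rhoX x n : x \in G -> mx (x ^+ n)%g = mx x ^+ n.
Proof.
move=> xG; elim: n => [|n IHn]; first by rewrite expg0 mxof_rho1 expr0.
by rewrite expgSr mxof_rhoM ?groupX// IHn exprS.
Qed.

Lemma det_rho1 : d 1%g = 1.
Proof. by rewrite /lfun_det mxof_rho1 det1. Qed.

Lemma det_rhoM x y : x \in G -> y \in G -> d (x * y)%g = d x * d y.
Proof. by move=> xG yG; rewrite /lfun_det mxof_rhoM// det_mulmx mulrC. Qed.

(* Otherwise unification of two determinants unfolds the Leibniz formula. *)
Local Opaque lfun_det.

Lemma det_rhoX x n : x \in G -> d (x ^+ n)%g = d x ^+ n.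
Proof.
move=> xG; elim: n => [|n IHn]; first by rewrite expg0 det_rho1 expr0.
by rewrite expgS det_rhoM ?groupX// IHn exprS.
Qed.

Lemma det_rhoV x : x \in G -> d x * d x^-1%g = 1.
Proof. by move=> xG; rewrite -det_rhoM ?groupV// mulgV det_rho1. Qed.

Lemma det_rhoJ x y : x \in G -> y \in G -> d (x ^ y)%g = d x.
Proof.
move=> xG yG; rewrite conjgE !det_rhoM ?groupM ?groupV//.
move: (d x) (d y) (d y^-1%g) (det_rhoV yG) => a b c bc.
by rewrite mulrCA (mulrC c) bc mulr1.
Qed.

Lemma pstabP (H : {vspace V}) x :
  reflect (x \in G /\ {in H, rho x =1 id}) (x \in stab H).
Proof.
rewrite inE; apply: (iffP andP) => -[xG Hx]; split=> //; exact/fixedSpacesP.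
Qed.

(** * Pointwise stabilizers and orthogonality for the powers of chi_H *)

Lemma pstab_sub H : stab H \subset G.
Proof. by apply/fintype.subsetP => x /pstabP[]. Qed.

Lemma pstab_group_set H : group_set (stab H).
Proof.
case: rhoP => rho1 rhoM _ _; apply/group_setP; split.
  by apply/pstabP; split=> // v _; rewrite rho1 lfunE.
move=> x y /pstabP[xG fx] /pstabP[yG fy]; apply/pstabP; split=> [|v vH].
  exact: groupM.
by rewrite rhoM// comp_lfunE fy// fx.
Qed.

Canonical pstab_group H := Group (pstab_group_set H).

Lemma ord_gt0 H : (0 < ord H)%N.
Proof. exact: (cardG_gt0 (pstab_group H)). Qed.

Lemma natr_ord_neq0 H : (ord H)%:R != 0 :> F.
Proof. by rewrite pnatr_eq0 -lt0n ord_gt0. Qed.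

(** Since [rho x - 1] kills [H], its matrix has rank at most 1, and [rank1_finite_order_det1]
    applies with the order of [x] as exponent. *)
Lemma pstab_det1 H x : hyperplane H -> x \in stab H -> d x = 1 -> x = 1%g.
Proof.
move=> /eqP dimH /pstabP[xG fx] dx.
have Mx1 : mx x = 1%:M.
  apply: rank1_finite_order_det1 dx (order_gt0 x) _; last first.
    by rewrite -mxof_rhoX// expg_order mxof_rho1.
  rewrite -mxof_rho1 -linearB; apply: (rank_mxof_codim1 basisV (H := H)).
    by rewrite dimH.
  by case: rhoP => -> _ _ _; apply/fixedSpacesP.
case: rhoP => _ _ rhoI _; apply: rhoI => //.
by apply: (can_inj (mxofK basisV basisV)); rewrite Mx1 mxof_rho1.
Qed.

Lemma pstab_det_inj H : hyperplane H -> {in stab H &, injective (fun x => d x)}.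
Proof.
move=> hH x y xH yH dxy; have sHG := fintype.subsetP (pstab_sub H).
have [xG yG] := (sHG x xH, sHG y yH).
apply/eqP; rewrite eq_mulgV1; apply/eqP/(pstab_det1 hH).
  by rewrite groupM ?groupV.
by rewrite det_rhoM ?groupV// dxy det_rhoV.
Qed.

Lemma sum_det_pstab H i : hyperplane H -> (0 < i < ord H)%N ->
  \sum_(x in stab H) d x ^+ i = 0.
Proof.
move=> hH /andP[i_gt0 lti].
(* Were chi_H^i trivial, the e_H distinct determinants would all be roots of [X^i - 1], which has at
   most [i < e_H] roots. *)
have [y yH dy] : exists2 y, y \in stab H & d y ^+ i != 1.
  apply/exists_inP; apply: contraLR lti => /exists_inPn dstab.
  rewrite -leqNgt /ord_hyp cardE -(size_map (fun x => d x)).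
  apply: max_unity_roots => //.
    apply/allP => _ /mapP[x + ->]; rewrite mem_enum => xH.
    by rewrite unity_rootE -[_ == _]negbK dstab.
  rewrite map_inj_in_uniq ?enum_uniq// => x z.
  by rewrite !mem_enum; apply: pstab_det_inj.
have sumE : d y ^+ i * \sum_(x in stab H) d x ^+ i = \sum_(x in stab H) d x ^+ i.
  rewrite mulr_sumr [RHS](reindex_inj (mulgI y)) /=.
  apply: eq_big => x; first by rewrite groupMl.
  by move=> xH; rewrite det_rhoM ?exprMn ?(fintype.subsetP (pstab_sub H)).
apply/eqP; apply: contraTT dy => sN0; rewrite negbK; apply/eqP.
by apply: (mulIf sN0); rewrite mul1r.
Qed.

(** For [x != 1] this is a geometric sum whose ratio differs from 1 and has e_H-th power 1. *)
Lemma sum_expr_det_pstab H x : hyperplane H -> x \in stab H ->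
  \sum_(i < ord H) d x ^+ i = ((ord H) * (x == 1%g))%N%:R.
Proof.
move=> hH xH; have xG := fintype.subsetP (pstab_sub H) _ xH.
have [->|xN1] := eqVneq x 1%g.
  rewrite det_rho1; under eq_bigr do rewrite expr1n.
  by rewrite sumr_const card_ord muln1.
have dN1 : d x - 1 != 0.
  by rewrite subr_eq0; apply: contra xN1 => /eqP/(pstab_det1 hH xH)->.
rewrite muln0; apply: (mulfI dN1); rewrite -subrX1 mulr0 -det_rhoX//.
by rewrite (expg_cardG (G := pstab_group H))// det_rho1 subrr.
Qed.

(** * The action of [G] on the reflection hyperplanes *)

Lemma rhoVK g : g \in G ->
  cancel (fun H => (rho g @: H)%VS) (fun H => (rho g^-1%g @: H)%VS).
Proof.
case: rhoP => rho1 rhoM _ _ gG H.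
by rewrite -limg_comp -rhoM ?groupV// mulVg rho1 lim1g.
Qed.

Lemma pstab_img g H : g \in G -> stab (rho g @: H)%VS = (stab H :^ g^-1)%g.
Proof.
case: rhoP => rho1 rhoM _ _.
(* One inclusion for arbitrary [a] and [H'] is enough: the converse is its instance at [g^-1] and
   the image of [H]. *)
have stabS a (H' : {vspace V}) x :
    a \in G -> x \in stab H' -> (x ^ a^-1)%g \in stab (rho a @: H')%VS.
  move=> aG /pstabP[xG fx]; apply/pstabP; split; first by rewrite groupJ ?groupV.
  move=> _ /memv_imgP[v vH ->]; rewrite -comp_lfunE -rhoM ?groupJ ?groupV//.
  by rewrite conjgE invgK -!mulgA mulVg mulg1 rhoM// comp_lfunE fx.
move=> gG; apply/setP => x; rewrite mem_conjg invgK.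
apply/idP/idP => [xH|/(stabS g _ _ gG)]; last by rewrite conjgK.
by rewrite -(rhoVK gG H) -{1}(invgK g); apply: stabS; rewrite ?groupV.
Qed.

Lemma hyps_img g H : g \in G -> hyps H -> hyps (rho g @: H)%VS.
Proof.
move=> gG [/eqP dimH stabN1].
split; last by rewrite pstab_img// -(inj_eq (@conjsg_inj _ g)) conjsgKV conjs1g.
rewrite /hyperplane -dimH limg_dim_eq//; apply/eqP; rewrite -subv0.
apply/subvP => v; rewrite memv_cap memv_ker => /andP[_ /eqP gv0].
case: rhoP => rho1 rhoM _ _.
rewrite memv0 -[v]id_lfunE -rho1 -(mulVg g) rhoM ?groupV// comp_lfunE gv0.
by rewrite linear0.
Qed.

Lemma horbit_img g H : g \in G -> orb (rho g @: H)%VS = orb H.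
Proof.
case: rhoP => rho1 rhoM _ _ gG; apply/seteqP; split=> _ [x /= xG <-].
  by exists (x * g)%g; rewrite /= ?groupM// rhoM// limg_comp.
exists (x * g^-1)%g; rewrite /= ?groupM ?groupV// rhoM ?groupV// limg_comp.
by rewrite rhoVK.
Qed.

Lemma hyps_img_bij g : g \in G -> set_bij hyps hyps (fun H => (rho g @: H)%VS).
Proof.
move=> gG; split=> [H hH|H H' _ _|H hH]; first exact: hyps_img.
  exact: (can_inj (rhoVK gG)).
exists (rho g^-1%g @: H)%VS; first by apply: hyps_img; rewrite ?groupV.
by rewrite -[X in rho X](invgK g) rhoVK ?groupV.
Qed.

(** * The operators tau(S_H,i) and the action of [z(k)] *)

Section Representation.

Variables (m : nat) (tau : mx_representation F G m).

(** This is tau(S_H,i). Leaving out the denominator [e_H] makes it preserve a lattice. *)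
Definition pstab_sum H i := \sum_(x in stab H) d x ^+ i *: tau x.

Lemma pstab_sum_absorb H i y : y \in stab H ->
  d y ^+ i *: tau y *m pstab_sum H i = pstab_sum H i.
Proof.
move=> yH; have sHG := fintype.subsetP (pstab_sub H).
rewrite mulmx_sumr [RHS](reindex_inj (mulgI y)) /=.
apply: eq_big => x; first by rewrite (groupMl (G := pstab_group H)).
move=> xH; rewrite det_rhoM ?repr_mxM ?sHG// exprMn.
by rewrite -scalemxAl -scalemxAr scalerA.
Qed.

Lemma pstab_sum_sqr H i :
  pstab_sum H i *m pstab_sum H i = (ord H)%:R *: pstab_sum H i.
Proof.
rewrite {1}/pstab_sum mulmx_suml.
under eq_bigr => y yH do rewrite pstab_sum_absorb//.
by rewrite sumr_const scaler_nat.
Qed.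

Lemma mxtrace_pstab_sum H i :
  \tr (pstab_sum H i) = (ord H * \rank (pstab_sum H i))%:R.
Proof.
have e0 := natr_ord_neq0 H.
have := @mxtrace_idem _ _ ((ord H)%:R^-1 *: pstab_sum H i).
rewrite -scalemxAl -scalemxAr pstab_sum_sqr !scalerA -mulrA mulVf// mulr1.
rewrite mxtraceZ mxrank_scale_nz ?invr_eq0// natrM => /(_ erefl) <-.
by rewrite mulrA mulfV// mul1r.
Qed.

Lemma pstab_sum_conj g H i : g \in G ->
  tau g *m pstab_sum H i = pstab_sum (rho g @: H)%VS i *m tau g.
Proof.
move=> gG; rewrite mulmx_sumr mulmx_suml pstab_img//.
rewrite [RHS](reindex_inj (conjg_inj g^-1%g)).
apply: eq_big => x; first by rewrite memJ_conjg.
move=> xH; have xG := fintype.subsetP (pstab_sub H) _ xH.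
rewrite det_rhoJ ?groupV// -scalemxAl -scalemxAr -!repr_mxM ?groupJ ?groupV//.
by rewrite conjgE invgK -!mulgA mulVg mulg1.
Qed.

(** The factor [e_H] in [a_elt] cancels the denominator of [epsilon]. *)
Lemma gring_op_a_elt k H : gring_op tau (a_elt G rho k H) =
  \sum_(1 <= i < ord H) k (orb H) i *: pstab_sum H i.
Proof.
rewrite raddf_sum /=; apply: eq_bigr => i _; rewrite /epsilon scalerA.
rewrite mulrAC mulfV ?natr_ord_neq0// mul1r linearZ/= raddf_sum /=; congr (_ *: _).
apply: eq_bigr => x xH; rewrite linearZ/= gring_opG//.
exact: (fintype.subsetP (pstab_sub H)).
Qed.

Lemma gring_op_z_elt k : gring_op tau (z_elt G rho k) =
  \sum_(H \in hyps) \sum_(1 <= i < ord H) k (orb H) i *: pstab_sum H i.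
Proof.
have hfin := refl_hyperplanes_finite rhoP.
rewrite /z_elt !fsbig_finite// raddf_sum.
by apply: eq_bigr => H _; rewrite -gring_op_a_elt.
Qed.

(** Conjugation by [g] permutes the summands through the bijection sending [H] to its image, and
    both [k] and [e_H] are constant on orbits. *)
Lemma gring_op_z_elt_comm k g : g \in G ->
  tau g *m gring_op tau (z_elt G rho k) = gring_op tau (z_elt G rho k) *m tau g.
Proof.
move=> gG; have hfin := refl_hyperplanes_finite rhoP.
rewrite gring_op_z_elt [in RHS](reindex_fsbig _ _ _ _ (hyps_img_bij gG)).
rewrite [in LHS]fsbig_finite// [in RHS]fsbig_finite//.
rewrite [LHS]mulmx_sumr [RHS]mulmx_suml; apply: eq_bigr => H _.
rewrite horbit_img// (ord_hyp_orbit rhoP (H := H)); last by exists g.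
rewrite [LHS]mulmx_sumr [RHS]mulmx_suml; apply: eq_bigr => i _.
by rewrite -scalemxAl -scalemxAr pstab_sum_conj.
Qed.

End Representation.

(** This is [gring_op_z_elt_comm] for the regular representation, where [gring_op] is the identity
    on the group ring. *)
Lemma z_elt_center k : (z_elt G rho k \in 'Z(group_ring F G))%MS.
Proof.
have zG : (z_elt G rho k \in group_ring F G)%MS.
  rewrite /z_elt fsbig_finite; last exact: refl_hyperplanes_finite rhoP.
  rewrite linear_sum summx_sub// => H _; rewrite linear_sum summx_sub// => i _.
  rewrite !linearZ !scalemx_sub// linear_sum summx_sub// => x xH.
  rewrite linearZ scalemx_sub// envelop_mx_id//.
  exact: (fintype.subsetP (pstab_sub H)).
apply/center_mxP; split=> // _ /envelop_mxP[b ->].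
rewrite mulmx_suml mulmx_sumr; apply: eq_bigr => x xG.
rewrite -scalemxAl -scalemxAr -(gring_op_id zG) gring_op_z_elt_comm//.
Qed.

(** * The coefficients of the scalar *)

Definition single_parameter (C : set {vspace V}) (i : nat) : parameter V :=
  fun C' j => ((C' == C) && (j == i))%:R.

Lemma sum_single_parameter m (tau : mx_representation F G m) C i H :
  \sum_(1 <= j < ord H) single_parameter C i (orb H) j *: pstab_sum tau H j =
  if (orb H == C) && (0 < i < ord H)%N then pstab_sum tau H i else 0.
Proof.
rewrite /single_parameter; case: eqP => /= [_|_]; last first.
  by rewrite big1// => j _; rewrite scale0r.
have [iH|iH] := boolP (0 < i < ord H)%N.
  rewrite (bigD1_seq i) ?mem_index_iota ?iota_uniq//= eqxx scale1r.
  by rewrite big1 ?addr0// => j /negbTE ->; rewrite scale0r.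
rewrite big_seq big1// => j; rewrite mem_index_iota => jH.
by case: eqP jH => [->|_ _]; [rewrite (negbTE iH)|rewrite scale0r].
Qed.

Lemma gring_op_z_elt_single m (tau : mx_representation F G m) k :
  gring_op tau (z_elt G rho k) =
  \sum_(C \in horbits G rho) \sum_(1 <= i < ord_orb G rho C)
    k C i *: gring_op tau (z_elt G rho (single_parameter C i)).
Proof.
have hfin := refl_hyperplanes_finite rhoP.
have ofin : finite_set (horbits G rho) by apply: finite_image.
(* The sum over [H] is moved outermost; for fixed [H] only the orbit [C] of [H] contributes. *)
under [RHS]eq_fsbigr => C _.
  under eq_bigr => i _.
    rewrite gring_op_z_elt fsbig_finite// scaler_sumr.
    under eq_bigr do rewrite sum_single_parameter.
    over.
  rewrite exchange_big. over.
rewrite gring_op_z_elt (fsbig_finite _ _ hfin) (fsbig_finite _ _ ofin) exchange_big.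
apply: eq_big_seq => H; rewrite in_fset_set// => /set_mem hH.
have oH : orb H \in fset_set (horbits G rho).
  by rewrite in_fset_set// inE; exists H.
rewrite (bigD1_seq (orb H)) ?fset_uniq//= (ord_orbE rhoP).
rewrite [X in _ + X]big1 ?addr0 => [|C /negbTE CH]; last first.
  by rewrite big1// => i _; rewrite eq_sym CH scaler0.
by apply: eq_big_seq => i; rewrite mem_index_iota eqxx => ->.
Qed.

Lemma integral_on_pstab_sum m (tau : mx_representation F G m) H i :
  integral_on (fun t : gT * gT =>
    if (t.1 \in G) && (t.2 \in G) then d t.1 *: tau t.2 else 0) (pstab_sum tau H i).
Proof.
apply: (big_ind (integral_on _)).
- exact: integral_on0.
- exact: integral_onD.
move=> x xH; have xG := fintype.subsetP (pstab_sub H) _ xH.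
apply: (@integral_on_map _ _ _ _ _ _ (fun t => (x ^+ i * t.1, x * t.2)%g)).
move=> [h g] /=; rewrite !groupMl ?groupX//.
case: ifP => [/andP[hG gG]|_]; last by rewrite mulmx0.
rewrite -scalemxAl -scalemxAr scalerA repr_mxM// det_rhoM ?groupX//.
by rewrite det_rhoX.
Qed.

Lemma mxtrace_z_elt_single m (tau : mx_representation F G m) C i :
  \tr (gring_op tau (z_elt G rho (single_parameter C i))) =
  (\sum_(H <- fset_set hyps | (orb H == C) && (0 < i < ord H))
     ord H * \rank (pstab_sum tau H i))%N%:R.
Proof.
have hfin := refl_hyperplanes_finite rhoP.
rewrite gring_op_z_elt fsbig_finite// raddf_sum natr_sum [RHS]big_mkcond.
apply: eq_bigr => H _; rewrite sum_single_parameter.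
by case: ifP => _; rewrite /= ?mxtrace_pstab_sum ?mxtrace0.
Qed.

Lemma z_elt_single_scalar m (tau : mx_representation F G m) C i :
  mx_irreducible tau -> exists n : nat,
    gring_op tau (z_elt G rho (single_parameter C i)) = n%:R%:M.
Proof.
move=> irr; have [m_gt0 _] := (mx_irrP _).1 irr.
have hfin := refl_hyperplanes_finite rhoP.
set z := gring_op _ _.
(* Schur's lemma over an algebraically closed field. *)
have /is_scalar_mxP[c zE] : is_scalar_mx z.
  apply: (mx_abs_irr_cent_scalar (group_closure_closed_field irr)).
  by apply/centgmxP => x xG; rewrite gring_op_z_elt_comm.
pose N := (\sum_(H <- fset_set hyps | (orb H == C) && (0 < i < ord H))
             ord H * \rank (pstab_sum tau H i))%N.
(* Comparing traces gives [c m = N]. *)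
pose q : rat := N%:R / m%:R.
have cE : c = ratr q.
  have m0 : m%:R != 0 :> F by rewrite pnatr_eq0 -lt0n.
  rewrite fmorph_div /= !ratr_nat; apply: (mulIf m0); rewrite mulfVK//.
  by rewrite mulr_natr -mxtrace_scalar -zE mxtrace_z_elt_single.
have : q \is a Num.int.
  (* The index [(1, 1)] carries the identity matrix, which is nonzero because [m > 0]. *)
  apply: (@integral_on_ratr _ _ _ F (fun t : gT * gT =>
    if (t.1 \in G) && (t.2 \in G) then d t.1 *: tau t.2 else 0) _ (1, 1)%g).
    by rewrite /= !group1 det_rho1 scale1r repr_mx1 -mxrank_eq0 mxrank1 -lt0n.
  rewrite -cE -zE /z gring_op_z_elt fsbig_finite//.
  apply: (big_ind (integral_on _)) => [||H _]; first exact: integral_on0.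
    exact: integral_onD.
  rewrite sum_single_parameter; case: ifP => _; last exact: integral_on0.
  exact: integral_on_pstab_sum.
rewrite intrEge0 ?divr_ge0 ?ler0n// => /natrP[n qn].
by exists n; rewrite zE cE qn ratr_nat.
Qed.

(** * Vanishing of the scalar and the trivial representation *)

Lemma pstab_sum_eq0 m (tau : mx_representation F G m) H i :
  (forall k, gring_op tau (z_elt G rho k) = 0) -> hyps H -> (0 < i < ord H)%N ->
  pstab_sum tau H i = 0.
Proof.
move=> z0 hH iH; have hfin := refl_hyperplanes_finite rhoP.
(* The trace is a sum of natural numbers [e_H] times a rank, so nothing cancels and each rank is
   0. *)
have := mxtrace_z_elt_single tau (orb H) i; rewrite z0 mxtrace0 => /esym/eqP.
rewrite pnatr_eq0 sum_nat_seq_eq0 => /allP/(_ H).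
rewrite in_fset_set// inE eqxx iH /= => /(_ hH).
by rewrite muln_eq0 gtn_eqF ?ord_gt0//= mxrank_eq0 => /eqP.
Qed.

Lemma pstab_sub_rker m (tau : mx_representation F G m) H :
  (forall k, gring_op tau (z_elt G rho k) = 0) -> hyps H -> stab H \subset rker tau.
Proof.
move=> z0 hH; have [hyp _] := hH.
(* The terms with [0 < i] vanish, so the [i = 0] term equals the full sum over [i], in which
   orthogonality leaves only the identity of [G]. *)
have sum0 : pstab_sum tau H 0 = (ord H)%:R%:M.
  have -> : pstab_sum tau H 0 = \sum_(i < ord H) pstab_sum tau H i.
    rewrite -(big_mkord xpredT (pstab_sum tau H)) big_ltn ?ord_gt0//.
    rewrite big_seq big1 ?addr0// => i; rewrite mem_index_iota.
    exact: pstab_sum_eq0.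
  rewrite exchange_big (bigD1 1%g) /=; last exact: (group1 (pstab_group H)).
  rewrite -scaler_suml sum_expr_det_pstab ?(group1 (pstab_group H))//.
  rewrite eqxx muln1 repr_mx1 scalemx1 big1 ?addr0// => x /andP[xH /negbTE xN1].
  by rewrite -scaler_suml sum_expr_det_pstab// xN1 muln0 scale0r.
apply/fintype.subsetP => x xH; apply/rkerP; split.
  exact: (fintype.subsetP (pstab_sub H)).
(* Absorption with [i = 0] now reads [e_H tau x = e_H]. *)
have := pstab_sum_absorb tau 0 xH; rewrite sum0 expr0 scale1r mul_mx_scalar.
rewrite -[in RHS]scalemx1 => /(congr1 (fun A => (ord H)%:R^-1 *: A)).
by rewrite !scalerA mulVf ?natr_ord_neq0// !scale1r.
Qed.

Lemma gring_op_z_elt_rker m (tau : mx_representation F G m) k :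
  G \subset rker tau -> gring_op tau (z_elt G rho k) = 0.
Proof.
move=> /fintype.subsetP Gker; rewrite gring_op_z_elt.
apply: fsbig1 => H [hyp _]; rewrite big_seq big1// => i.
rewrite mem_index_iota => iH.
rewrite /pstab_sum (eq_bigr (fun x => d x ^+ i *: 1%:M)) => [|x xH].
  by rewrite -scaler_suml sum_det_pstab// scale0r scaler0.
by have /rkerP[_ ->] := Gker x (fintype.subsetP (pstab_sub H) x xH).
Qed.

Lemma complex_reflection_hyps g : g \in G -> complex_reflection rho g ->
  hyps (lker (rho g - \1%VF)) /\ g \in stab (lker (rho g - \1%VF)).
Proof.
move=> gG hg; have gH : g \in stab (lker (rho g - \1%VF)).
  by rewrite inE gG /fixedSpace subvv.
split=> //; split=> //; apply/eqP => stab1.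
have g1 : g = 1%g by apply/set1gP; rewrite -stab1.
(* The identity fixes all of [V], which is not a hyperplane. *)
case: rhoP hg => rho1 _ _ _; rewrite /complex_reflection /hyperplane g1 rho1.
by rewrite -/(fixedSpace _) fixedSpace_id eqn_leq ltnn.
Qed.

Lemma mx_rsim_triv_rker m (tau : mx_representation F G m) :
  mx_irreducible tau -> G \subset rker tau -> mx_rsim tau (triv_repr F G).
Proof.
(* The kernel contains the derived subgroup, so [tau] has degree 1. *)
move=> irr Gker; have /eqP m1 : m == 1%N.
  rewrite -(der1_sub_rker (@group_closure_closed_field _ _ G) irr).
  exact: fintype.subset_trans (der_sub 1 G) Gker.
subst m; exists 1%:M => // [|x xG]; first by rewrite /row_free mxrank1.
by have /rkerP[_ ->] := fintype.subsetP Gker x xG.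
Qed.

End FiniteLinearGroup.

Theorem lemma2p5 (R : realType) (V : vectType R[i])
    (form : {dot V for (@Num.conj R[i])})
    (gT : finGroupType) (G : {group gT}) (rho : gT -> 'End(V))
    (hG : complex_reflection_group G rho form) :
  (forall k : parameter V, (z_elt G rho k \in 'Z(group_ring R[i] G))%MS) /\
  (forall (m : nat) (tau : mx_representation R[i] G m),
     mx_irreducible tau ->
     exists c : parameter V -> R[i],
     [/\ forall k, acts_by_scalar tau (z_elt G rho k) (c k),
         exists n : set {vspace V} -> nat -> nat, forall k,
           c k = \sum_(C \in horbits G rho) \sum_(1 <= i < ord_orb G rho C)
                   (n C i)%:R * k C i
       & (forall k, c k = 0) <-> mx_rsim tau (triv_repr R[i] G)]).
Proof.
have [rhoP genG] := hG; split=> [k|m tau irr]; first exact: z_elt_center rhoP k.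
(* The coefficient of [k C i] is the scalar of the indicator parameter of [(C, i)]. *)
have [n nE] := choice (fun Ci => z_elt_single_scalar rhoP Ci.1 Ci.2 irr).
pose c (k : parameter V) : R[i] :=
  \sum_(C \in horbits G rho) \sum_(1 <= i < ord_orb G rho C)
    (n (C, i))%:R * k C i.
have zE k : gring_op tau (z_elt G rho k) = (c k)%:M.
  have ofin : finite_set (horbits G rho).
    exact/finite_image/(refl_hyperplanes_finite rhoP).
  rewrite /c (gring_op_z_elt_single rhoP) !fsbig_finite// raddf_sum.
  apply: eq_bigr => C _; rewrite raddf_sum; apply: eq_bigr => i _.
  by rewrite (nE (C, i)) scale_scalar_mx mulrC.
exists c; split; [exact: zE|by exists (fun C i => n (C, i))|].
have [m_gt0 _] := (mx_irrP _).1 irr.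
have c0P : (forall k, c k = 0) <-> (forall k, gring_op tau (z_elt G rho k) = 0).
  split=> c0 k'; first by rewrite zE c0 raddf0.
  have /matrixP/(_ (Ordinal m_gt0) (Ordinal m_gt0)) := c0 k'.
  by rewrite zE !mxE eqxx.
split=> [/c0P z0|simtriv].
  (* The reflections generate [G], so it suffices that each lies in the kernel of [tau]. *)
  apply: mx_rsim_triv_rker => //; rewrite -{1}genG gen_subG.
  apply/fintype.subsetP => g /setIdP[gG hg].
  have [hH gH] := complex_reflection_hyps rhoP gG hg.
  exact: (fintype.subsetP (pstab_sub_rker rhoP z0 hH)).
apply/c0P => k; apply: (gring_op_z_elt_rker rhoP).
rewrite (rker_mx_rsim simtriv); apply/fintype.subsetP => x xG.
exact/rkerP.
Qed.
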